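(* Let $\Lambda$ be a left hereditary ring and $f:A\twoheadrightarrow B$ an epimorphism of $\Lambda$-modules. The following conditions are equivalent: (1) $\underline{f}$ is a normal epimorphism in the stable category $\Lambda\text{-}\underline{\mathrm{Mod}}$; (2) every homomorphism $\alpha:\mathrm{Ker}\, f\to P$ with $P$ projective is $f$-split.
   Context: Rings are associative with identity; modules are left modules. The stable category $\Lambda\text{-}\underline{\mathrm{Mod}}$ has all left $\Lambda$-modules as objects; its morphisms are classes $\underline{f}$ of $\Lambda$-homomorphisms $f$, where $f$ and $g$ are equivalent if $f-g$ factors through a projective module. An epimorphism in a category is normal if it is a cokernel of some morphism. Let $f:A\twoheadrightarrow B$ be an epimorphism of $\Lambda$-modules, with short exact sequence $[f]:\ 0\to\mathrm{Ker}\, f\xrightarrow{i}A\xrightarrow{f}B\to 0$. For a homomorphism $\alpha:\mathrm{Ker}\, f\to X$, let $\alpha[f]:\ 0\to X\to D\to B\to 0$ be the short exact sequence obtained from $[f]$ by pushout along $\alpha$. We say (terminology introduced here) that $\alpha$ is $f$-split if the following conditions, which are equivalent to each other for every $\alpha$, hold: (i) $\alpha[f]$ splits; (ii) any chain map from $[f]$ to a short exact sequence $0\to X\to Y\to Z\to 0$ with left component $\alpha$ is null-homotopic; (iii) for any exact sequence $X\xrightarrow{\delta}Y\xrightarrow{\gamma}Z\to 0$ and any homomorphisms $g:A\to Y$, $h:B\to Z$ with $gi=\delta\alpha$ and $hf=\gamma g$, there exist $s:B\to Y$ and $s':A\to X$ such that $g=sf+\delta s'$ and $h=\gamma s$. 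*)

(* Defs.v *)
From HB Require Import structures.
From mathcomp Require Import all_boot all_algebra.
From mathcomp Require Import boolp prodnormedzmodule.

Set Implicit Arguments.
Unset Strict Implicit.
Unset Printing Implicit Defensive.

Import GRing.Theory.

Local Open Scope ring_scope.
Local Open Scope quotient_scope.

(* Rings are [pzRingType]s, so that the zero ring is allowed. *)

Record category0 : Type := Category0 {
  obj :> Type;
  hom : obj -> obj -> Type;
  idm : forall A, hom A A;
  comp : forall A B C, hom B C -> hom A B -> hom A C;
  zerom : forall A B, hom A B;
  comp_idl : forall A B (f : hom A B), comp (idm B) f = f;
  comp_idr : forall A B (f : hom A B), comp f (idm A) = f;
  compA : forall A B C D (h : hom C D) (g : hom B C) (f : hom A B),
    comp h (comp g f) = comp (comp h g) f;
  comp_zerol : forall A B C (f : hom A B), comp (zerom B C) f = zerom A C;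
  comp_zeror : forall A B C (g : hom B C), comp g (zerom A B) = zerom A C
}.

Section NormalEpi.
Variable C : category0.

Definition epic (A B : C) (e : hom A B) : Prop :=
  forall (D : C) (g h : hom B D), comp g e = comp h e -> g = h.

Definition is_cokernel (K A B : C) (k : hom K A) (e : hom A B) : Prop :=
  comp e k = zerom K B /\
  forall (D : C) (h : hom A D), comp h k = zerom K D ->
    exists! u : hom B D, comp u e = h.

Definition normal_epi (A B : C) (e : hom A B) : Prop :=
  epic e /\ exists (K : C) (k : hom K A), is_cokernel k e.

End NormalEpi.

Section Modules.
Variable R : pzRingType.
Implicit Types A B C D M N P X : lmodType R.

Definition surjective A B (f : A -> B) : Prop := forall b, exists a, f a = b.

Definition projective P : Prop :=
  forall M N (p : {linear M -> N}) (h : {linear P -> N}), surjective p ->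
    exists h' : {linear P -> M}, forall x, p (h' x) = h x.

(* Submodules of projective modules are projective; a submodule of [P] is given
   up to isomorphism by an injective homomorphism into [P]. *)
Definition left_hereditary : Prop :=
  forall P M (j : {linear M -> P}),
    projective P -> injective j -> projective M.

Lemma projective0 P : (forall x : P, x = 0) -> projective P.
Proof.
move=> P0 M N p h _; exists \0 => x.
by rewrite (P0 x) !raddf0.
Qed.

Lemma projective_prod P Q :
  projective P -> projective Q -> projective (P * Q)%type.
Proof.
move=> projP projQ M N p h sp.
pose inl (x : P) : (P * Q)%type := (x, 0).
pose inr (y : Q) : (P * Q)%type := (0, y).
have inl_lin : linear inl.
  by move=> a x y; congr pair; rewrite /= scaler0 addr0.
have inr_lin : linear inr.
  by move=> a x y; congr pair; rewrite /= scaler0 addr0.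
pose inlL : {linear P -> (P * Q)%type} :=
  HB.pack inl (GRing.isLinear.Build _ _ _ _ inl inl_lin).
pose inrL : {linear Q -> (P * Q)%type} :=
  HB.pack inr (GRing.isLinear.Build _ _ _ _ inr inr_lin).
have [u uE] := projP M N p (h \o inlL) sp.
have [v vE] := projQ M N p (h \o inrL) sp.
exists ((u \o fst) \+ (v \o snd)) => -[x y] /=.
rewrite linearD uE vE /= -linearD; congr (h (_, _)).
  exact: addr0.
exact: add0r.
Qed.

Definition factors_projective A B (f : A -> B) : Prop :=
  exists P (u : {linear A -> P}) (v : {linear P -> B}),
    projective P /\ forall x, f x = v (u x).

Definition stable_eq A B (f g : {linear A -> B}) : bool :=
  `[< factors_projective (f \- g) >].

Lemma stable_eqP A B (f g : {linear A -> B}) :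
  reflect (factors_projective (f \- g)) (stable_eq f g).
Proof. exact: asboolP. Qed.

Lemma factors_projective0 A B (f : A -> B) :
  (forall x, f x = 0) -> factors_projective f.
Proof.
move=> f0; exists ('M[R]_(0, 0) : lmodType R), \0, \0; split=> //.
by apply: projective0 => x; apply/matrixP => -[].
Qed.

Lemma stable_eq_refl A B : reflexive (@stable_eq A B).
Proof.
move=> f; apply/stable_eqP/factors_projective0 => x /=.
exact: subrr.
Qed.

Lemma stable_eq_sym A B : symmetric (@stable_eq A B).
Proof.
suff imp f g : @stable_eq A B f g -> stable_eq g f.
  by move=> f g; apply/idP/idP; apply: imp.
move=> /stable_eqP[P [u [v [projP uv]]]]; apply/stable_eqP.
exists P, u, (\- v); split=> // x /=.
by rewrite -uv /= opprB.
Qed.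

Lemma stable_eq_trans A B : transitive (@stable_eq A B).
Proof.
move=> g f h /stable_eqP[P [u [v [projP uv]]]].
move=> /stable_eqP[Q [u' [v' [projQ uv']]]]; apply/stable_eqP.
pose w (x : A) : (P * Q)%type := (u x, u' x).
have w_lin : linear w by move=> a x y; congr pair; exact: linearP.
pose wL : {linear A -> (P * Q)%type} :=
  HB.pack w (GRing.isLinear.Build _ _ _ _ w w_lin).
exists (P * Q)%type, wL, ((v \o fst) \+ (v' \o snd)).
split; first exact: projective_prod.
by move=> x /=; rewrite -uv -uv' /= addrA subrK.
Qed.

Canonical stable_eq_equiv A B :=
  EquivRel (@stable_eq A B) (@stable_eq_refl A B) (@stable_eq_sym A B)
    (@stable_eq_trans A B).

Definition stable_hom A B := {eq_quot (@stable_eq A B)}.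

Definition stable_class A B (f : {linear A -> B}) : stable_hom A B :=
  \pi_(stable_hom A B) f.

Lemma stable_classP A B (f g : {linear A -> B}) :
  stable_class f = stable_class g <-> factors_projective (f \- g).
Proof.
split; first by move/eqquotP/stable_eqP.
by move=> fg; apply/eqquotP/stable_eqP.
Qed.

Lemma stable_class_eqfun A B (f g : {linear A -> B}) :
  f =1 g -> stable_class f = stable_class g.
Proof.
move=> fg; apply/stable_classP/factors_projective0 => x /=.
by rewrite fg subrr.
Qed.

Lemma stable_class_repr A B (f : stable_hom A B) : stable_class (repr f) = f.
Proof. exact: reprK. Qed.

Definition stable_comp A B C (g : stable_hom B C) (f : stable_hom A B) :
  stable_hom A C := stable_class (repr g \o repr f).

Lemma stable_compE A B C (g : {linear B -> C}) (f : {linear A -> B}) :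
  stable_comp (stable_class g) (stable_class f) = stable_class (g \o f).
Proof.
have /stable_classP[P [u [v [projP uv]]]] := stable_class_repr (stable_class g).
have /stable_classP[Q [u' [v' [projQ uv']]]] :=
  stable_class_repr (stable_class f).
rewrite /stable_comp; set g' := repr _ in uv *; set f' := repr _ in uv' *.
transitivity (stable_class (g \o f')); apply/stable_classP.
  by exists P, (u \o f'), v; split=> // x; rewrite /= -uv.
by exists Q, u', (g \o v'); split=> // x; rewrite /= -uv' /= linearB.
Qed.

Definition stable_id A : stable_hom A A := stable_class (idfun : {linear A -> A}).

Definition stable_zero A B : stable_hom A B :=
  stable_class (\0 : {linear A -> B}).

Lemma stable_comp_idl A B (f : stable_hom A B) :
  stable_comp (stable_id B) f = f.
Proof.
rewrite -[f]stable_class_repr stable_compE.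
exact: stable_class_eqfun.
Qed.

Lemma stable_comp_idr A B (f : stable_hom A B) :
  stable_comp f (stable_id A) = f.
Proof.
rewrite -[f]stable_class_repr stable_compE.
exact: stable_class_eqfun.
Qed.

Lemma stable_compA A B C D (h : stable_hom C D) (g : stable_hom B C)
    (f : stable_hom A B) :
  stable_comp h (stable_comp g f) = stable_comp (stable_comp h g) f.
Proof.
rewrite -[f]stable_class_repr -[g]stable_class_repr -[h]stable_class_repr.
by rewrite !stable_compE; apply: stable_class_eqfun.
Qed.

Lemma stable_comp_zerol A B C (f : stable_hom A B) :
  stable_comp (stable_zero B C) f = stable_zero A C.
Proof.
rewrite -[f]stable_class_repr stable_compE.
exact: stable_class_eqfun.
Qed.

Lemma stable_comp_zeror A B C (g : stable_hom B C) :
  stable_comp g (stable_zero A B) = stable_zero A C.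
Proof.
rewrite -[g]stable_class_repr stable_compE.
by apply: stable_class_eqfun => x /=; rewrite linear0.
Qed.

Definition stable_category : category0 :=
  Category0 stable_comp_idl stable_comp_idr stable_compA
    stable_comp_zerol stable_comp_zeror.

Section Kernel.
Variables (A B : lmodType R) (f : {linear A -> B}).

Definition in_ker : {pred A} := fun x => f x == 0.

Lemma in_ker_closed : submod_closed in_ker.
Proof.
split=> [|a x y]; first by rewrite unfold_in linear0.
rewrite !unfold_in => /eqP x0 /eqP y0.
by rewrite linearP x0 y0 scaler0 addr0.
Qed.

HB.instance Definition _ := GRing.isSubmodClosed.Build R A in_ker
  (GRing.submod_closed_semi in_ker_closed).

Definition Ker : Type := {x : A | x \in in_ker}.
HB.instance Definition _ := SubChoice.on Ker.
HB.instance Definition _ := [SubChoice_isSubLmodule of Ker by <:].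

Definition ker_incl : {linear Ker -> A} := val.

Lemma ker_incl_inj : injective ker_incl.
Proof. exact: val_inj. Qed.

Lemma ker_inclP (a : A) : f a = 0 <-> exists k : Ker, ker_incl k = a.
Proof.
split=> [/eqP a0|[k <-]]; last exact/eqP/(valP k).
by exists (Sub a a0); exact: SubK.
Qed.

End Kernel.

Section QuotientModule.
Variables (V : lmodType R) (N : submodClosed V).

Definition submod_zmodClosed : zmodClosed V :=
  HB.pack (GRing.SubmodClosed.sort N) (GRing.isZmodClosed.Build V (GRing.SubmodClosed.sort N)
    (GRing.submod_closedB (GRing.submodClosedP N))).

Definition quotmod := Quotient.quot submod_zmodClosed.
HB.instance Definition _ := GRing.Zmodule.on quotmod.

Definition quotmod_pi (v : V) : quotmod := \pi_(Quotient.quot submod_zmodClosed) v.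

Definition quotmod_repr (q : quotmod) : V := repr (q : Quotient.quot submod_zmodClosed).

Lemma quotmod_reprK : cancel quotmod_repr quotmod_pi.
Proof. move=> q; exact: reprK. Qed.

Lemma quotmod_piP (v w : V) : quotmod_pi v = quotmod_pi w <-> v - w \in N.
Proof.
have -> : (v - w \in N) = (quotmod_pi v == quotmod_pi w).
  exact: (Quotient.idealrBE submod_zmodClosed).
by split=> /eqP.
Qed.

Lemma quotmod_piD (v w : V) : quotmod_pi (v + w) = quotmod_pi v + quotmod_pi w.
Proof. exact: raddfD. Qed.

Definition quotmod_scale (a : R) (q : quotmod) : quotmod :=
  quotmod_pi (a *: quotmod_repr q).

Lemma quotmod_scaleE a v : quotmod_scale a (quotmod_pi v) = quotmod_pi (a *: v).
Proof.
apply/quotmod_piP; rewrite -scalerBr rpredZ //.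
by apply/quotmod_piP; rewrite quotmod_reprK.
Qed.

Lemma quotmod_scaleA a b q :
  quotmod_scale a (quotmod_scale b q) = quotmod_scale (a * b) q.
Proof. by rewrite -[q]quotmod_reprK !quotmod_scaleE scalerA. Qed.

Lemma quotmod_scale1 : left_id 1 quotmod_scale.
Proof. by move=> q; rewrite -[q]quotmod_reprK quotmod_scaleE scale1r. Qed.

Lemma quotmod_scaleDr : right_distributive quotmod_scale +%R.
Proof.
move=> a q r; rewrite -[q]quotmod_reprK -[r]quotmod_reprK.
by rewrite -quotmod_piD !quotmod_scaleE scalerDr quotmod_piD.
Qed.

Lemma quotmod_scaleDl q : {morph quotmod_scale^~ q : a b / a + b}.
Proof.
move=> a b; rewrite -[q]quotmod_reprK.
by rewrite !quotmod_scaleE scalerDl quotmod_piD.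
Qed.

HB.instance Definition _ := GRing.Zmodule_isLmodule.Build R quotmod
  quotmod_scaleA quotmod_scale1 quotmod_scaleDr quotmod_scaleDl.

Lemma quotmod_pi_linear : linear quotmod_pi.
Proof. by move=> a v w; rewrite quotmod_piD -quotmod_scaleE. Qed.

HB.instance Definition _ :=
  GRing.isLinear.Build R V quotmod _ quotmod_pi quotmod_pi_linear.

End QuotientModule.

(* Short exact sequences 0 -> X -> D -> B -> 0. *)
Record ses X B : Type := Ses {
  ses_mid : lmodType R;
  ses_in : {linear X -> ses_mid};
  ses_out : {linear ses_mid -> B};
  ses_in_inj : injective ses_in;
  ses_exact : forall d, ses_out d = 0 <-> exists x, ses_in x = d;
  ses_out_surj : surjective ses_out
}.

Definition splits X B (E : ses X B) : Prop :=
  exists s : {linear B -> ses_mid E}, forall b, ses_out E (s b) = b.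

Definition epi_ses A B (f : {linear A -> B}) (f_surj : surjective f) :
  ses (Ker f) B := Ses (@ker_incl_inj _ _ f) (@ker_inclP _ _ f) f_surj.

(* The pushout of [E : 0 -> K -i-> A -p-> B -> 0] along [alpha : K -> X] is
   0 -> X -> (X * A) / {(alpha k, - i k)} -> B -> 0. *)
Section Pushout.
Variables (K X B : lmodType R) (E : ses K B) (alpha : {linear K -> X}).
Local Notation A := (ses_mid E).

Definition in_antidiag : {pred X * A} :=
  fun u => `[< exists k, u = (alpha k, - ses_in E k) >].

Lemma in_antidiagP u :
  reflect (exists k, u = (alpha k, - ses_in E k)) (u \in in_antidiag).
Proof. exact: asboolP. Qed.

Lemma in_antidiag_closed : submod_closed in_antidiag.
Proof.
split=> [|a _ _ /in_antidiagP[k ->] /in_antidiagP[l ->]]; apply/in_antidiagP.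
  by exists 0; congr pair; rewrite linear0 ?oppr0.
exists (a *: k + l); congr pair => /=; first by rewrite linearP.
by rewrite linearP opprD scalerN.
Qed.

HB.instance Definition _ := GRing.isSubmodClosed.Build R (X * A)%type in_antidiag
  (GRing.submod_closed_semi in_antidiag_closed).

Definition pushout : lmodType R := quotmod in_antidiag.

Definition pushout_pi (u : X * A) : pushout := quotmod_pi in_antidiag u.

Lemma pushout_pi_linear : linear pushout_pi.
Proof. exact: quotmod_pi_linear. Qed.

HB.instance Definition _ :=
  GRing.isLinear.Build R (X * A)%type pushout _ pushout_pi pushout_pi_linear.

Lemma pushout_piP (u v : X * A) :
  pushout_pi u = pushout_pi v <-> exists k, u - v = (alpha k, - ses_in E k).
Proof.
split; first by move/quotmod_piP/in_antidiagP.
by move=> uv; apply/quotmod_piP/in_antidiagP.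
Qed.

Lemma pushout_ind (T : pushout -> Prop) :
  (forall x a, T (pushout_pi (x, a))) -> forall d, T d.
Proof.
move=> TP d; rewrite -[d]quotmod_reprK.
by case: (quotmod_repr d) => x a; apply: TP.
Qed.

Definition pushout_in (x : X) : pushout := pushout_pi (x, 0).

Lemma pushout_in_linear : linear pushout_in.
Proof.
move=> a x y; rewrite /pushout_in -linearP; congr (pushout_pi (_, _)).
by rewrite /= scaler0 addr0.
Qed.

HB.instance Definition _ :=
  GRing.isLinear.Build R X pushout _ pushout_in pushout_in_linear.

Definition pushout_out (d : pushout) : B := ses_out E (quotmod_repr d).2.

Lemma pushout_outE x a : pushout_out (pushout_pi (x, a)) = ses_out E a.
Proof.
have /pushout_piP[k /(congr1 snd) /= e] := quotmod_reprK (pushout_pi (x, a)).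
apply/eqP; rewrite -subr_eq0 -linearB e; apply/eqP/ses_exact.
by exists (- k); rewrite linearN.
Qed.

Lemma pushout_out_linear : linear pushout_out.
Proof.
move=> c d e; elim/pushout_ind: d => x a; elim/pushout_ind: e => y b.
by rewrite -linearP !pushout_outE linearP.
Qed.

HB.instance Definition _ :=
  GRing.isLinear.Build R pushout B _ pushout_out pushout_out_linear.

Lemma pushout_in_inj : injective pushout_in.
Proof.
move=> x y /pushout_piP[k [exy /esym]].
rewrite subrr => /eqP; rewrite oppr_eq0 => /eqP.
rewrite -(linear0 (ses_in E)) => /ses_in_inj k0.
by apply/eqP; rewrite -subr_eq0 exy k0 linear0.
Qed.

Lemma pushout_exact d : pushout_out d = 0 <-> exists x, pushout_in x = d.
Proof.
split=> [|[x <-]]; last by rewrite pushout_outE linear0.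
elim/pushout_ind: d => x a; rewrite pushout_outE => /ses_exact[k <-].
exists (x + alpha k); apply/pushout_piP; exists k.
congr pair => /=; last exact: sub0r.
by rewrite addrAC subrr add0r.
Qed.

Lemma pushout_out_surj : surjective pushout_out.
Proof.
move=> b; have [a <-] := ses_out_surj E b.
by exists (pushout_pi (0, a)); rewrite pushout_outE.
Qed.

Definition pushout_ses : ses X B :=
  Ses pushout_in_inj pushout_exact pushout_out_surj.

End Pushout.

Definition f_split A B (f : {linear A -> B}) (f_surj : surjective f)
    X (alpha : {linear Ker f -> X}) : Prop :=
  splits (pushout_ses (epi_ses f_surj) alpha).

End Modules.

(* Main.v *)
Require Import Defs.
From HB Require Import structures.
From mathcomp Require Import all_boot all_algebra.
From mathcomp Require Import boolp.

Set Implicit Arguments.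
Unset Strict Implicit.
Unset Printing Implicit Defensive.

Import GRing.Theory.

Local Open Scope ring_scope.

(** A homomorphism [Ker f -> X] is f-split exactly when it extends to [A].

If f is the cokernel of k, then k may be changed by a map through a projective
module so that it lands in [Ker f].  For [alpha : Ker f -> P], the map from [A]
to the pushout [D] of [f] along [alpha] then kills k stably, so it factors
stably as w f with [w : B -> D].  As f is stably epic, w is a section of
[D -> B] up to a map through a projective module, and such a map lifts
along [D -> B]; hence the pushout sequence splits.

Conversely, extending to [A] the maps from [Ker f] to projective modules shows
that f is a weak cokernel of its kernel inclusion.  To see that f is stably
epic, let w f = v u with [u : A -> P] and [P] projective; then u maps [Ker f]
into [Ker v], which is projective because the ring is left hereditary, so
[u|Ker f] extends to [t : A -> Ker v], and u - t factors through f. *)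

Section Linear.
Variable R : pzRingType.
Implicit Types A B D P X Y : lmodType R.

(** Preimages under [j] are unique, so choosing them is linear. *)
Lemma linear_lift_inj A X Y (j : {linear X -> Y}) (g : {linear A -> Y}) :
    injective j -> (forall a, exists x, j x = g a) ->
  exists t : {linear A -> X}, forall a, j (t a) = g a.
Proof.
move=> j_inj jg; pose t a := sval (cid (jg a)).
have tE a : j (t a) = g a by rewrite /t; case: cid.
have t_lin : linear t.
  by move=> c a b; apply: j_inj; rewrite linearP !tE linearP.
pose tL : {linear A -> X} := HB.pack t (GRing.isLinear.Build _ _ _ _ t t_lin).
by exists tL.
Qed.

(** As [h] kills the kernel of [f], composing it with any set-theoretic section of [f] gives a
    linear map. *)
Lemma linear_factor_surj A B D (f : {linear A -> B}) (h : {linear A -> D}) :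
    surjective f -> (forall a, f a = 0 -> h a = 0) ->
  exists w : {linear B -> D}, forall a, w (f a) = h a.
Proof.
move=> f_surj fh; pose s b := sval (cid (f_surj b)).
have sE b : f (s b) = b by rewrite /s; case: cid.
have wE a : h (s (f a)) = h a.
  by apply/eqP; rewrite -subr_eq0 -linearB fh // linearB sE subrr.
pose w := h \o s; have w_lin : linear w.
  move=> c x y; rewrite /w /= -[in LHS](sE x) -[in LHS](sE y).
  by rewrite -linearP wE linearP.
pose wL : {linear B -> D} := HB.pack w (GRing.isLinear.Build _ _ _ _ w w_lin).
by exists wL.
Qed.

Lemma stable_class_eq0 A B (g : {linear A -> B}) :
  stable_class g = stable_zero A B <-> factors_projective g.
Proof.
split=> [/stable_classP|] [P [u [v [projP uv]]]].
  by exists P, u, v; split=> // x; rewrite -uv /= subr0.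
by apply/stable_classP; exists P, u, v; split=> // x; rewrite -uv /= subr0.
Qed.

(** Only the leg [P -> B] has to be lifted, so the lift still vanishes stably and may be used as a
    correction term. *)
Lemma projective_lift_factor A B D (p : {linear D -> B}) (g : {linear A -> B}) :
    surjective p -> factors_projective g ->
  exists g' : {linear A -> D},
    factors_projective g' /\ forall a, p (g' a) = g a.
Proof.
move=> p_surj [P [u [v [projP uv]]]]; have [v' vE] := projP _ _ p v p_surj.
exists (v' \o u); split=> [|a]; last by rewrite uv /= vE.
by exists P, u, v'.
Qed.

End Linear.

Section PushoutMid.
Variables (R : pzRingType) (K X B : lmodType R) (E : ses K B).
Variable alpha : {linear K -> X}.

Definition pushout_mid (a : ses_mid E) : pushout E alpha :=
  pushout_pi alpha (0, a).

Lemma pushout_mid_linear : linear pushout_mid.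
Proof.
move=> c a b; rewrite /pushout_mid -linearP; congr pushout_pi.
by congr pair; rewrite /= scaler0 addr0.
Qed.

HB.instance Definition _ := GRing.isLinear.Build R (ses_mid E) (pushout E alpha)
  _ pushout_mid pushout_mid_linear.

Lemma pushout_mid_in k :
  pushout_mid (ses_in E k) = pushout_in E alpha (alpha k).
Proof.
(* The sign fits [(0, i k) - (alpha k, 0) = (alpha (- k), - i (- k))], where [i] is [ses_in E]. *)
apply/pushout_piP; exists (- k).
by congr pair; rewrite /= ?linearN ?opprK ?sub0r ?subr0.
Qed.

End PushoutMid.

Section Epi.
Variables (R : pzRingType) (A B : lmodType R) (f : {linear A -> B}).
Hypothesis f_surj : surjective f.
Implicit Types D P X : lmodType R.

(** For a section [s], the map [mid - s f] lands in the image of [X]; on [Ker f] the term [s f]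
    vanishes, leaving [alpha]. *)
Lemma f_split_extends X (alpha : {linear Ker f -> X}) :
  f_split f_surj alpha ->
  exists t : {linear A -> X}, forall k, t (ker_incl f k) = alpha k.
Proof.
move=> [s sE].
pose E := epi_ses f_surj.
pose mid : {linear A -> pushout E alpha} :=
  (pushout_mid alpha : {linear ses_mid E -> _}).
pose s' : {linear B -> pushout E alpha} := s.
pose rho : {linear A -> pushout E alpha} := mid \- (s' \o f).
have [|t tE] := @linear_lift_inj _ _ _ _ (pushout_in E alpha) rho
  (@pushout_in_inj _ _ _ _ E alpha).
  move=> a; apply/pushout_exact.
  by rewrite linearB /= [X in _ - X]sE pushout_outE subrr.
exists t => k; apply: (@pushout_in_inj _ _ _ _ E alpha); rewrite tE /=.
rewrite (_ : s' (f (val k)) = 0) ?subr0; last by rewrite (eqP (valP k)) linear0.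
exact: (@pushout_mid_in _ _ _ _ E).
Qed.

Lemma normal_epi_f_split P (alpha : {linear Ker f -> P}) :
    @normal_epi (stable_category R) A B (stable_class f) ->
  projective P -> f_split f_surj alpha.
Proof.
move=> [f_epic [M [k [/= fk0 f_univ]]]] projP.
pose E := epi_ses f_surj.
rewrite -[k]stable_class_repr stable_compE in fk0 f_univ.
move: (repr k) fk0 f_univ => {}k /stable_class_eq0 fk0 f_univ.
have [k1 [[Q [u [v [projQ uv]]]] k1E]] := projective_lift_factor f_surj fk0.
have [|k2 k2E] := @linear_lift_inj _ _ _ _ (ker_incl f) (k \- k1)
  (@ker_incl_inj _ _ _ f).
  by move=> m; apply/ker_inclP; rewrite linearB /= k1E subrr.
pose rho : {linear A -> pushout E alpha} :=
  (pushout_mid alpha : {linear ses_mid E -> _}).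
have rhok x : rho (ker_incl f x) = pushout_in E alpha (alpha x).
  exact: (@pushout_mid_in _ _ _ _ E).
(* Stably [k] is [k2] followed by the inclusion, so [rho k] passes through [alpha], hence through
   [P]. *)
have rhok0 : stable_comp (stable_class rho) (stable_class k) =
    stable_zero M (pushout E alpha).
  have -> : stable_class k = stable_class (ker_incl f \o k2).
    apply/stable_classP; exists Q, u, v; split=> // m.
    by rewrite -uv /= [val _]k2E /= opprB addrC subrK.
  rewrite stable_compE; apply/stable_class_eq0.
  by exists P, (alpha \o k2), (pushout_in E alpha); split=> // m; exact: rhok.
have [w [wE _]] := f_univ _ _ rhok0.
rewrite -[w]stable_class_repr in wE; move: (repr w) wE => {}w wE.
pose p : {linear pushout E alpha -> B} := pushout_out (E := E) (alpha := alpha).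
(* Stably [p w f = p rho = f], and [f] cancels. *)
have pw : stable_class (p \o w) = stable_id B.
  apply: f_epic.
  rewrite /= -[stable_class (p \o w)]stable_compE -stable_compA.
  rewrite [stable_comp (stable_class w) _]wE stable_comp_idl stable_compE.
  by apply: stable_class_eqfun => a; exact: pushout_outE.
(* The defect [id - p w] lifts along [p] to [g'], making [w + g'] a strict section. *)
have /stable_classP := esym pw.
move=> /projective_lift_factor -/(_ _ p (pushout_out_surj E alpha)).
move=> [g' [_ g'E]]; exists (w \+ g') => b.
by rewrite linearD /= [X in _ + X]g'E /= addrC subrK.
Qed.

(** The form in which the splitting condition enters the converse, by [f_split_extends]. *)
Hypothesis ext : forall P (alpha : {linear Ker f -> P}), projective P ->
  exists t : {linear A -> P}, forall k, t (ker_incl f k) = alpha k.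

(** Extending [u] to [t] makes [h - v t] vanish on [Ker f], while [v t] is stably zero. *)
Lemma stable_factor D (h : {linear A -> D}) :
    factors_projective (h \o ker_incl f) ->
  exists w : {linear B -> D}, stable_class (w \o f) = stable_class h.
Proof.
move=> [P [u [v [projP uv]]]]; have [t tE] := ext u projP.
have [a|w wE] := @linear_factor_surj _ _ _ _ f (h \- (v \o t)) f_surj.
  by move=> /ker_inclP[k <-]; rewrite /= [t _]tE -uv subrr.
exists w; apply/esym/stable_classP; exists P, t, v; split=> // a.
by rewrite /= wE /= opprB addrC subrK.
Qed.

Lemma stable_epic D (w : {linear B -> D}) :
  left_hereditary R -> factors_projective (w \o f) -> factors_projective w.
Proof.
move=> hered [P [u [v [projP uv]]]].
have [k|u1 u1E] := @linear_lift_inj _ _ _ _ (ker_incl v) (u \o ker_incl f)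
  (@ker_incl_inj _ _ _ v).
  apply/ker_inclP; rewrite /= -uv /= (_ : f _ = 0) ?linear0 //.
  by apply/ker_inclP; exists k.
have [t tE] := ext u1 (hered _ _ _ projP (@ker_incl_inj _ _ _ v)).
have [a|u' u'E] :=
  @linear_factor_surj _ _ _ _ f (u \- (ker_incl v \o t)) f_surj.
  by move=> /ker_inclP[k <-]; rewrite /= [t _]tE [val (u1 _)]u1E subrr.
(* Since [v] kills the values of [t], [v u' f = v u = w f], and [f] is onto. *)
exists P, u', v; split=> // b; have [a <-] := f_surj b.
rewrite u'E linearB /= -uv (_ : v (val _) = 0) ?subr0 //.
exact/eqP/(valP (t a)).
Qed.

Lemma extends_normal_epi : left_hereditary R ->
  @normal_epi (stable_category R) A B (stable_class f).
Proof.
move=> hered.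
have f_epic : @epic (stable_category R) A B (stable_class f).
  move=> D g h /=; rewrite -[g]stable_class_repr -[h]stable_class_repr.
  rewrite !stable_compE => /stable_classP gh; apply/stable_classP.
  exact: (@stable_epic D (repr g \- repr h)).
split=> //; exists (Ker f : lmodType R), (stable_class (ker_incl f)).
split=> [|D h] /=.
  rewrite stable_compE; apply/stable_class_eq0/factors_projective0 => k.
  exact/eqP/(valP k).
rewrite -[h]stable_class_repr stable_compE.
move=> /stable_class_eq0/stable_factor[w wE].
exists (stable_class w); split=> [|w' w'E]; first by rewrite stable_compE.
(* Epicness supplies the uniqueness that a weak cokernel lacks. *)
by apply: f_epic; rewrite /= w'E stable_compE.
Qed.

End Epi.

Theorem theorem8p9 (Lambda : pzRingType) (hered : left_hereditary Lambda)
    (A B : lmodType Lambda) (f : {linear A -> B}) (f_surj : surjective f) :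
  @normal_epi (stable_category Lambda) A B (stable_class f)
  <->
  (forall (P : lmodType Lambda) (alpha : {linear Ker f -> P}),
     projective P -> f_split f_surj alpha).
Proof.
split=> [f_normal P alpha|split_f]; first exact: normal_epi_f_split.
apply: extends_normal_epi hered => // P alpha projP.
exact/f_split_extends/split_f.
Qed.
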